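(* Let $\mathcal S,\mathcal A$ be finite sets, $\mathcal X=\mathcal S\times\mathcal A$, $\gamma\in(0,1)$, $\rho\ge0$, and let $\phi(s,a)\in\mathbb{R}^d$, $(s,a)\in\mathcal X$, be given feature vectors. For $x\in\mathcal X$, $s'\in\mathcal S$, $\theta\in\mathbb{R}^d$ define $$\mathcal E_\rho(x,s',\theta)=\gamma\,\phi(x)\max_{a'\in\mathcal A}\ \min_{\theta'\in\mathcal B_\rho(\theta)}\phi(s',a')^\top\theta',\qquad \mathcal B_\rho(\theta)=\{\theta'\in\mathbb{R}^d:\|\theta-\theta'\|_2^2\le\rho\}.$$ Then, for all $x\in\mathcal X$, $s'\in\mathcal S$, $\theta\in\mathbb{R}^d$, $$\mathcal E_\rho(x,s',\theta)=\gamma\,\phi(x)\max_{a'\in\mathcal A}\Big\{\phi(s',a')^\top\theta-\sqrt\rho\,\|\phi(s',a')\|_2\Big\}.$$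
   Context: $\mathcal S$ and $\mathcal A$ are the state and action spaces of a finite MDP with discount factor $\gamma$; $\mathcal E_\rho$ is the robust estimator used in 2RA Q-learning. $\|\cdot\|_2$ is the Euclidean norm. *)

(* Defs.v *)
From HB Require Import structures.
From mathcomp Require Import all_boot all_order all_algebra.
From mathcomp Require Import all_classical all_reals.

Set Implicit Arguments.
Unset Strict Implicit.
Unset Printing Implicit Defensive.

Import Order.TTheory GRing.Theory Num.Theory.
Local Open Scope classical_set_scope.
Local Open Scope ring_scope.

(* The norm the library puts on matrices is the sup norm, hence an explicit
   Euclidean norm and inner product on 'cV[R]_d. *)
Definition dotv (R : realType) (d : nat) (u v : 'cV[R]_d) : R :=
  (u^T *m v) 0 0.

Definition norm2 (R : realType) (d : nat) (u : 'cV[R]_d) : R :=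
  Num.sqrt (\sum_(i < d) u i 0 ^+ 2).

(* The radius of this ball is the square root of rho. *)
Definition ball2 (R : realType) (d : nat) (rho : R) (theta : 'cV[R]_d) :
    set 'cV[R]_d :=
  [set theta' | norm2 (theta - theta') ^+ 2 <= rho].

(* The least element of E, not merely its infimum; it defaults to 0 when E has
   no least element. *)
Definition set_min (R : realType) (E : set R) : R :=
  xget 0 (E `&` lbound E).

Lemma set_min_eq (R : realType) (E : set R) (m : R) :
  E m -> lbound E m -> set_min E = m.
Proof.
move=> Em lem; apply: xget_subset1; first by split.
move=> x y [Ex lex] [Ey ley].
by apply/eqP; rewrite eq_le lex // ley.
Qed.

(* The point t0 only witnesses that T is nonempty: as f t0 is itself one of the
   values of f, the result does not depend on it. *)
Definition fin_max (R : realType) (T : finType) (t0 : T) (f : T -> R) : R :=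
  \big[Num.max/f t0]_(t : T) f t.

(* The action x.2 witnesses that A is nonempty. *)
Definition robust_estimator (R : realType) (S A : finType) (d : nat)
    (gamma : R) (phi : S * A -> 'cV[R]_d) (rho : R)
    (x : S * A) (s' : S) (theta : 'cV[R]_d) : 'cV[R]_d :=
  (gamma * fin_max x.2 (fun a' : A =>
     set_min [set dotv (phi (s', a')) theta' | theta' in ball2 rho theta]))
  *: phi x.

(* Main.v *)
(* By Cauchy-Schwarz, u . theta' >= u . theta - sqrt rho ||u|| on the ball of
   radius sqrt rho around theta, with equality at
   theta - (sqrt rho / ||u||) u. *)
Require Import Defs.
From HB Require Import structures.
From mathcomp Require Import all_boot all_order all_algebra.
From mathcomp Require Import all_classical all_reals.
From mathcomp Require Import ring.

Import Order.TTheory GRing.Theory Num.Theory.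
Local Open Scope ring_scope.

(** For each action the inner problem minimises a linear form over a Euclidean ball.
    [cauchy_schwarz_dotv] bounds it from below, and stepping from the centre against [u] attains the
    bound ([set_min_dotv_ball2]). The outer maximum then compares equal functions of the action. *)

Lemma dotvC (R : realType) (d : nat) (u v : 'cV[R]_d) : dotv u v = dotv v u.
Proof. by rewrite /dotv !mxE; apply: eq_bigr => i _; rewrite !mxE mulrC. Qed.

Lemma dotvBr (R : realType) (d : nat) (u v w : 'cV[R]_d) :
  dotv u (v - w) = dotv u v - dotv u w.
Proof. by rewrite /dotv mulmxBr !mxE. Qed.

Lemma dotvZr (R : realType) (d : nat) (c : R) (u v : 'cV[R]_d) :
  dotv u (c *: v) = c * dotv u v.
Proof. by rewrite /dotv -scalemxAr mxE. Qed.

Lemma dotvv (R : realType) (d : nat) (u : 'cV[R]_d) :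
  dotv u u = \sum_(i < d) u i 0 ^+ 2.
Proof. by rewrite /dotv mxE; apply: eq_bigr => i _; rewrite mxE expr2. Qed.

Lemma norm2_ge0 (R : realType) (d : nat) (u : 'cV[R]_d) : 0 <= norm2 u.
Proof. exact: sqrtr_ge0. Qed.

Lemma dotvv_ge0 (R : realType) (d : nat) (u : 'cV[R]_d) : 0 <= dotv u u.
Proof. by rewrite dotvv; apply: sumr_ge0 => i _; exact: sqr_ge0. Qed.

Lemma sqr_norm2 (R : realType) (d : nat) (u : 'cV[R]_d) :
  norm2 u ^+ 2 = dotv u u.
Proof. by rewrite /norm2 -dotvv sqr_sqrtr ?dotvv_ge0. Qed.

Lemma dotvv_eq0 (R : realType) (d : nat) (u : 'cV[R]_d) :
  dotv u u = 0 -> u = 0.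
Proof.
rewrite dotvv => /eqP; rewrite psumr_eq0; last by move=> i _; exact: sqr_ge0.
move=> /allP u0; apply/colP => i; rewrite mxE.
by apply/eqP; rewrite -sqrf_eq0; apply: u0; rewrite mem_index_enum.
Qed.

Lemma cauchy_schwarz_dotv (R : realType) (d : nat) (u v : 'cV[R]_d) :
  dotv u v <= norm2 u * norm2 v.
Proof.
have [v0|v_neq0] := eqVneq (dotv v v) 0.
  have uv0 : dotv u v = 0.
    by rewrite (dotvv_eq0 _ _ _ v0) /dotv mulmx0 mxE.
  by rewrite uv0 mulr_ge0 ?norm2_ge0.
have v_gt0 : 0 < dotv v v by rewrite lt_def v_neq0 dotvv_ge0.
(* Since [dotv u v] may be negative, its absolute value is bounded instead, so that both sides can
   be squared. *)
apply: (le_trans (ler_norm _)).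
rewrite -ler_sqr ?nnegrE ?mulr_ge0 ?norm2_ge0 //.
rewrite real_normK ?num_real // exprMn !sqr_norm2 -(ler_pM2l v_gt0) -subr_ge0.
(* [w] is the component of [u] orthogonal to [v], scaled by [dotv v v] to avoid a division. *)
pose w := dotv v v *: u - dotv u v *: v.
have -> : dotv v v * (dotv u u * dotv v v) - dotv v v * dotv u v ^+ 2 =
    dotv w w.
  rewrite {1}/w dotvBr !dotvZr !(dotvC _ _ w) !dotvBr !dotvZr (dotvC _ _ v u).
  by ring.
exact: dotvv_ge0.
Qed.

Lemma set_min_dotv_ball2 (R : realType) (d : nat) (rho : R)
    (u theta : 'cV[R]_d) : 0 <= rho ->
  set_min [set dotv u theta' | theta' in ball2 rho theta]%classic =
  dotv u theta - Num.sqrt rho * norm2 u.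
Proof.
move=> rho_ge0; apply: set_min_eq.
(* When u = 0 the division by zero gives theta itself as minimiser. *)
- exists (theta - (Num.sqrt rho / norm2 u) *: u); rewrite /ball2 /=.
    (* The squared distance to the centre is [rho] if [u] is nonzero, and 0 otherwise. *)
    rewrite subKr sqr_norm2 dotvZr dotvC dotvZr -sqr_norm2.
    have [->|u_neq0] := eqVneq (norm2 u) 0; first by rewrite expr0n /= !mulr0.
    suff <- : Num.sqrt rho ^+ 2 = Num.sqrt rho / norm2 u *
        (Num.sqrt rho / norm2 u * norm2 u ^+ 2) by rewrite sqr_sqrtr.
    by field.
  rewrite dotvBr dotvZr -sqr_norm2; congr (_ - _).
  have [->|u_neq0] := eqVneq (norm2 u) 0; first by rewrite expr0n /= !mulr0.
  by field.
- move=> _ [theta' theta'_ball <-].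
  have dist_le : norm2 (theta - theta') <= Num.sqrt rho.
    rewrite -ler_sqr ?nnegrE ?sqrtr_ge0 ?norm2_ge0 //.
    by rewrite (sqr_sqrtr rho_ge0).
  (* The bound rearranges to Cauchy-Schwarz for [u] and [theta - theta']. *)
  rewrite lerBlDr -lerBlDl -dotvBr (le_trans (cauchy_schwarz_dotv _ _ _ _)) //.
  by rewrite mulrC ler_wpM2r ?norm2_ge0.
Qed.

Theorem lemma3p1 (R : realType) (S A : finType) (d : nat) (gamma rho : R)
    (phi : S * A -> 'cV[R]_d)
    (hgamma0 : 0 < gamma) (hgamma1 : gamma < 1) (hrho : 0 <= rho)
    (x : S * A) (s' : S) (theta : 'cV[R]_d) :
  robust_estimator gamma phi rho x s' theta =
  (gamma * fin_max x.2 (fun a' : A =>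
     dotv (phi (s', a')) theta - Num.sqrt rho * norm2 (phi (s', a'))))
  *: phi x.
Proof.
rewrite /robust_estimator; congr ((_ * fin_max _ _) *: _).
(* Equality as functions also covers the initial value of the maximum, taken at [x.2]. *)
by apply/funext => a; exact: set_min_dotv_ball2.
Qed.
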